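(* Let $\{\mathcal{A},G,\sigma,\alpha\}$ be a $G$-crossed system with $G\neq\{e\}$ and $\mathcal{A}$ commutative. Let $D\subseteq\mathcal{A}$ be the set of zero-divisors of $\mathcal{A}$ (including $0_{\mathcal{A}}$) and $\tilde{D}=\{d\,\overline{e}\mid d\in D\}$. Then (i) implies (ii): (i) $I\cap(\tilde{\mathcal{A}}\setminus\tilde{D})\neq\emptyset$ for every non-zero two-sided ideal $I$ in $\mathcal{A}\rtimes_\alpha^\sigma G$. (ii) $D\cap\mathcal{A}^G=\{0_{\mathcal{A}}\}$, i.e. the only zero-divisor that is fixed under all the automorphisms $\sigma_s$, $s\in G$, is $0_{\mathcal{A}}$.
   Context: A $G$-crossed system is a quadruple $\{\mathcal{A},G,\sigma,\alpha\}$ consisting of a unital associative ring $\mathcal{A}$, a group $G$ with unit $e$, a map $\sigma:G\to\mathrm{Aut}(\mathcal{A})$, $x\mapsto\sigma_x$, into the ring automorphisms of $\mathcal{A}$, and a map $\alpha:G\times G\to U(\mathcal{A})$ into the group of invertible elements of $\mathcal{A}$, such that for all $x,y,z\in G$, $a\in\mathcal{A}$: (i) $\sigma_x(\sigma_y(a))=\alpha(x,y)\,\sigma_{xy}(a)\,\alpha(x,y)^{-1}$; (ii) $\alpha(x,y)\,\alpha(xy,z)=\sigma_x(\alpha(y,z))\,\alpha(x,yz)$; (iii) $\alpha(x,e)=\alpha(e,x)=1_{\mathcal{A}}$. The crossed product $\mathcal{A}\rtimes_\alpha^\sigma G$ is the free left $\mathcal{A}$-module with basis $\{\overline{g}: g\in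 G\}$ (a copy of $G$), made into an associative unital ring by the biadditive multiplication determined by $(a_1\overline{x})(a_2\overline{y})=a_1\sigma_x(a_2)\,\alpha(x,y)\,\overline{xy}$. Its elements are formal sums $\sum_{g\in G}a_g\overline{g}$ with $a_g\in\mathcal{A}$, all but finitely many zero. $\tilde{\mathcal{A}}=\{a\overline{e}\mid a\in\mathcal{A}\}$ is the embedded copy of $\mathcal{A}$. The fixed ring is $\mathcal{A}^G=\{a\in\mathcal{A}\mid\sigma_s(a)=a\ \forall s\in G\}$. An element $c\in\mathcal{A}$ is a zero-divisor if $cd=0_{\mathcal{A}}$ for some $d\in\mathcal{A}$, $d\neq0_{\mathcal{A}}$; by convention $0_{\mathcal{A}}\in D$ always. *)

(* Defs.v *)
From HB Require Import structures.
From mathcomp Require Import all_boot all_algebra.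
From mathcomp Require Import finmap.
From mathcomp.multinomials Require Import monalg.
From mathcomp Require Import boolp classical_sets.

Set Implicit Arguments.
Unset Strict Implicit.
Unset Printing Implicit Defensive.

Import GRing.Theory.

Local Open Scope classical_set_scope.
Local Open Scope ring_scope.

(* Rings are pzRingTypes, so the zero ring is allowed.  Since mathcomp only   *)
(* provides unit groups for rings with 1 != 0, U(A) is spelled out here.      *)
Record units (A : pzRingType) := Units {
  uval : A;
  uinv : A;
  umulV : uval * uinv = 1;
  umulVl : uinv * uval = 1
}.

Record crossed_system (A : pzRingType) (G : groupType) := CrossedSystem {
  cs_sigma : G -> {rmorphism A -> A};
  cs_alpha : G -> G -> units A;
  cs_sigma_bij : forall x, bijective (cs_sigma x);
  cs_sigmaM : forall x y a,
    cs_sigma x (cs_sigma y a)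
      = uval (cs_alpha x y) * cs_sigma (x * y)%g a * uinv (cs_alpha x y);
  cs_cocycle : forall x y z,
    uval (cs_alpha x y) * uval (cs_alpha (x * y)%g z)
      = cs_sigma x (uval (cs_alpha y z)) * uval (cs_alpha x (y * z)%g);
  cs_alphax1 : forall x, uval (cs_alpha x 1%g) = 1;
  cs_alpha1x : forall x, uval (cs_alpha 1%g x) = 1
}.

(* {malg A[G]} is the type of finitely supported functions from G to A. It is *)
(* used only as an additive group: the product below is the twisted one.      *)
Definition crossed_product (A : pzRingType) (G : groupType)
  (S : crossed_system A G) : Type := {malg A[G]}.

HB.instance Definition _ A G (S : @crossed_system A G) :=
  GRing.Zmodule.copy (crossed_product S) {malg A[G]}.

Section CrossedProduct.
Variables (A : pzRingType) (G : groupType) (S : crossed_system A G).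

Implicit Types (a b c : A) (x y z : G) (u v w : crossed_product S).

Definition monom a x : crossed_product S := << a *g x >>.

Definition cscale a u : crossed_product S :=
  \sum_(x <- msupp u) monom (a * u@_x) x.

Definition cone : crossed_product S := monom 1 1%g.

Definition cmul u v : crossed_product S :=
  \sum_(x <- msupp u) \sum_(y <- msupp v)
    monom (u@_x * cs_sigma S x (v@_y) * uval (cs_alpha S x y)) (x * y)%g.

Local Lemma monom0 x : monom 0 x = 0.
Proof. exact: monalgU0. Qed.

Local Lemma monomD a b x : monom (a + b) x = monom a x + monom b x.
Proof. exact: monalgUD. Qed.

Local Lemma cmsuppD u v :
  (msupp (u + v : crossed_product S)%R `<=` msupp u `|` msupp v)%fset.
Proof. exact: msuppD_le. Qed.

Local Lemma cmcoeffD x u v : (u + v : crossed_product S)@_x = u@_x + v@_x.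
Proof. exact: mcoeffD. Qed.

Local Lemma cmsupp0 : msupp (0 : crossed_product S) = fset0.
Proof. exact: msupp0. Qed.

Lemma crossedE u : u = \sum_(x <- msupp u) monom (u@_x) x.
Proof. exact: monalgE. Qed.

Lemma cscaleE a u x : (cscale a u)@_x = a * u@_x.
Proof.
rewrite {2}[u]crossedE /cscale !raddf_sum /= mulr_sumr.
by apply: eq_bigr => i _; rewrite !mcoeffU mulrnAr.
Qed.

Fact cscaleA a b u : cscale a (cscale b u) = cscale (a * b) u.
Proof. by apply/malgP=> x; rewrite !cscaleE mulrA. Qed.

Fact cscale1 : left_id 1 cscale.
Proof. by move=> u; apply/malgP=> x; rewrite cscaleE mul1r. Qed.

Fact cscaleDr : right_distributive cscale +%R.
Proof.
by move=> a u v; apply/malgP=> x; rewrite !(cmcoeffD, cscaleE) mulrDr.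
Qed.

Fact cscaleDl u a b : cscale (a + b) u = cscale a u + cscale b u.
Proof. by apply/malgP=> x; rewrite !(cmcoeffD, cscaleE) mulrDl. Qed.

HB.instance Definition _ :=
  GRing.Zmodule_isLmodule.Build A (crossed_product S)
    cscaleA cscale1 cscaleDr cscaleDl.

Local Lemma cmulw (d1 d2 : {fset G}) u v :
  (msupp u `<=` d1)%fset -> (msupp v `<=` d2)%fset ->
  cmul u v = \sum_(x <- d1) \sum_(y <- d2)
    monom (u@_x * cs_sigma S x (v@_y) * uval (cs_alpha S x y)) (x * y)%g.
Proof.
move=> le1 le2; rewrite /cmul (big_fset_incl _ le1) /=.
  apply/eq_bigr=> x _; apply/big_fset_incl => // y _ /mcoeff_outdom ->.
  by rewrite rmorph0 mulr0 mul0r monom0.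
move=> x _ /mcoeff_outdom u0.
by rewrite big1 => // y _; rewrite u0 !mul0r monom0.
Qed.

Fact cmulDl : left_distributive cmul +%R.
Proof.
move=> u v w.
rewrite [in RHS](cmulw (fsubsetUl _ (msupp v)) (fsubset_refl (msupp w))).
rewrite [in RHS](cmulw (fsubsetUr (msupp u) _) (fsubset_refl (msupp w))).
rewrite (cmulw (cmsuppD _ _) (fsubset_refl (msupp w))).
rewrite -big_split /=; apply/eq_bigr=> x _.
rewrite -big_split /=; apply/eq_bigr=> y _.
by rewrite cmcoeffD !mulrDl monomD.
Qed.

Fact cmulDr : right_distributive cmul +%R.
Proof.
move=> w u v.
rewrite [in RHS](cmulw (fsubset_refl (msupp w)) (fsubsetUl _ (msupp v))).
rewrite [in RHS](cmulw (fsubset_refl (msupp w)) (fsubsetUr (msupp u) _)).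
rewrite (cmulw (fsubset_refl (msupp w)) (cmsuppD _ _)).
rewrite -big_split /=; apply/eq_bigr=> x _.
rewrite -big_split /=; apply/eq_bigr=> y _.
by rewrite cmcoeffD rmorphD mulrDr mulrDl monomD.
Qed.

Local Lemma cmul0 : left_zero 0 cmul.
Proof. by move=> u; rewrite /cmul cmsupp0 big_seq_fset0. Qed.

Local Lemma cmulx0 : right_zero 0 cmul.
Proof.
by move=> u; rewrite /cmul big1 // => x _; rewrite cmsupp0 big_seq_fset0.
Qed.

Local Lemma cmulUU a b x y :
  cmul (monom a x) (monom b y)
    = monom (a * cs_sigma S x b * uval (cs_alpha S x y)) (x * y)%g.
Proof. by rewrite (cmulw msuppU_le msuppU_le) !big_seq_fset1 !mcoeffUU. Qed.

Local Lemma cmul_suml I (r : seq I) (F : I -> crossed_product S) v :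
  cmul (\sum_(i <- r) F i) v = \sum_(i <- r) cmul (F i) v.
Proof.
by apply: (big_morph (cmul^~ v)) => [? ?|]; [apply: cmulDl | apply: cmul0].
Qed.

Local Lemma cmul_sumr I (r : seq I) (F : I -> crossed_product S) u :
  cmul u (\sum_(i <- r) F i) = \sum_(i <- r) cmul u (F i).
Proof.
by apply: (big_morph (cmul u)) => [? ?|]; [apply: cmulDr | apply: cmulx0].
Qed.

Lemma cs_sigma1 a : cs_sigma S 1%g a = a.
Proof.
apply: (bij_inj (cs_sigma_bij S 1%g)).
have := umulV (cs_alpha S 1%g 1%g).
by rewrite cs_sigmaM mulg1 cs_alphax1 !mul1r => ->; rewrite mulr1.
Qed.

Fact cmul1 : left_id cone cmul.
Proof.
move=> u; rewrite {1}(crossedE u) cmul_sumr [RHS]crossedE.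
apply: eq_bigr => x _.
by rewrite cmulUU cs_sigma1 cs_alpha1x mul1r mulr1 mul1g.
Qed.

Fact cmulx1 : right_id cone cmul.
Proof.
move=> u; rewrite {1}(crossedE u) cmul_suml [RHS]crossedE.
apply: eq_bigr => x _.
by rewrite cmulUU rmorph1 cs_alphax1 !mulr1 mulg1.
Qed.

Fact cmulA : associative cmul.
Proof.
move=> u v w; rewrite (crossedE u) !cmul_suml; apply: eq_bigr => x _.
rewrite (crossedE v) cmul_suml !cmul_sumr cmul_suml; apply: eq_bigr => y _.
rewrite (crossedE w) !cmul_sumr; apply: eq_bigr => z _.
rewrite !cmulUU mulgA; congr (monom _ _).
rewrite !rmorphM -!mulrA -cs_cocycle cs_sigmaM -!mulrA.
by rewrite [uinv _ * _]mulrA umulVl mul1r.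
Qed.

HB.instance Definition _ :=
  GRing.Zmodule_isPzRing.Build (crossed_product S)
    cmulA cmul1 cmulx1 cmulDl cmulDr.

Lemma monomM a b x y :
  monom a x * monom b y
    = monom (a * cs_sigma S x b * uval (cs_alpha S x y)) (x * y)%g.
Proof. exact: cmulUU. Qed.

Lemma monomZ a b x : a *: monom b x = monom (a * b) x.
Proof. by apply/malgP=> y; rewrite cscaleE !mcoeffU mulrnAr. Qed.

Definition embed (X : set A) : set (crossed_product S) :=
  [set monom a 1%g | a in X].

Definition fixed_ring : set A := [set a | forall s, cs_sigma S s a = a].

End CrossedProduct.

Arguments monom {A G} S a x.
Arguments embed {A G} S X.
Arguments fixed_ring {A G} S.

Definition zero_divisors (A : pzRingType) : set A :=
  [set c | c = 0 \/ exists2 d, d != 0 & c * d = 0].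
Arguments zero_divisors : clear implicits.

Definition two_sided_ideal (R : pzRingType) (I : set R) : Prop :=
  [/\ I 0,
      forall u v, I u -> I v -> I (u - v),
      forall r u, I u -> I (r * u)
    & forall r u, I u -> I (u * r)].

(* Main.v *)
Require Import Defs.
From mathcomp Require Import all_boot all_algebra.
From mathcomp Require Import classical_sets.
From mathcomp Require Import boolp.
From mathcomp.multinomials Require Import monalg.

Import GRing.Theory.

Local Open Scope classical_set_scope.
Local Open Scope ring_scope.

(** A fixed element [c] of the commutative ring [A] commutes with the
    coefficients and with the basis elements of the crossed product, so it is
    central there ([monom1_comm]) and generates the two-sided ideal
    [c *: u], [u] ranging over the crossed product
    ([two_sided_ideal_central]).  If moreover [c * d = 0] with [d != 0], then
    [d] kills every coefficient of every element of this ideal, so the ideal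
    meets the embedded copy of [A] in zero-divisors only.  By the
    intersection hypothesis the ideal is zero, and hence so is its
    generator [c]. *)

Lemma two_sided_ideal_central (R : pzRingType) (z : R) :
  (forall u, GRing.comm u z) -> two_sided_ideal [set z * u | u in [set: R]].
Proof.
move=> zC; split.
- by exists 0; rewrite ?mulr0.
- by move=> _ _ [u _ <-] [v _ <-]; exists (u - v); rewrite ?mulrBr.
- by move=> r _ [u _ <-]; exists (r * u); rewrite // mulrA -zC -mulrA.
- by move=> r _ [u _ <-]; exists (u * r); rewrite // mulrA.
Qed.

Section CrossedProduct.
Variables (A : pzRingType) (G : groupType) (S : crossed_system A G).
Implicit Types (a : A) (x : G) (u : crossed_product S).

Lemma monom1_mul a u : monom S a 1%g * u = a *: u.
Proof.
rewrite [u in LHS]crossedE [u in RHS]crossedE mulr_sumr scaler_sumr.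
apply: eq_bigr => x _.
by rewrite monomM cs_sigma1 cs_alpha1x mulr1 mul1g monomZ.
Qed.

End CrossedProduct.

(** Moving [c] to the left past a basis element [x] turns it into
    [sigma_x c], which is [c] again; commutativity of [A] then moves it past
    the coefficient. *)
Lemma monom1_comm (A : comPzRingType) (G : groupType) (S : crossed_system A G)
    (c : A) :
  fixed_ring S c -> forall u : crossed_product S, GRing.comm u (monom S c 1%g).
Proof.
move=> cfix u; rewrite /GRing.comm monom1_mul [u in LHS]crossedE.
rewrite [u in RHS]crossedE mulr_suml scaler_sumr; apply: eq_bigr => x _.
by rewrite monomM cfix cs_alphax1 mulr1 mulg1 monomZ mulrC.
Qed.

Theorem theorem6p1 (A : comPzRingType) (G : groupType)
    (S : crossed_system A G) :
  [set: G] <> [set 1%g] ->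
  (forall I : set (crossed_product S),
     two_sided_ideal I -> I <> [set 0] ->
     I `&` (embed S [set: A] `\` embed S (zero_divisors A)) !=set0) ->
  zero_divisors A `&` fixed_ring S = [set 0].
Proof.
move=> _ meets; apply/seteqP; split=> [c [[//|[d d0 cd0]] cfix]|_ ->]; last first.
  by split; [left | move=> s; rewrite rmorph0].
apply: contrapT => /= c0.
pose I := [set monom S c 1%g * u | u in [set: crossed_product S]].
have I_neq0 : I <> [set 0].
  move=> I0; have : I (monom S c 1%g) by exists 1; rewrite ?mulr1.
  rewrite I0 /= => /(congr1 (mcoeff 1%g)); rewrite mcoeffUU => c_eq.
  by apply: c0; rewrite c_eq; exact: mcoeff0.
have [_ [[u _ <-] [[a _ aE] anD]]] :=
  meets I (two_sided_ideal_central _ _ (monom1_comm _ _ _ _ cfix)) I_neq0.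
apply: anD; exists a; last exact: aE.
right; exists d => //.
(* Comparing coefficients at the unit of [G] exhibits [a] as a multiple of
   [c]. *)
have -> : a = c * (u : {malg A[G]})@_1%g.
  move/(congr1 (mcoeff 1%g)): aE.
  by rewrite monom1_mul cscaleE mcoeffUU.
by rewrite mulrAC cd0 mul0r.
Qed.
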